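(* The category $\mathbf{NG}$ of numerically generated spaces is a cartesian closed category.
   Context: A topological space $X$ is numerically generated if it has the final topology with respect to all its singular simplexes, i.e. all continuous maps $\Delta^n \to X$, $n \ge 0$. $\mathbf{NG}$ is the full subcategory of the category of topological spaces and continuous maps consisting of numerically generated spaces. *)

(* Defs.v *)
From HB Require Import structures.
From mathcomp Require Import all_boot all_order all_algebra.
From mathcomp Require Import all_classical all_reals all_analysis.

Set Implicit Arguments.
Unset Strict Implicit.
Unset Printing Implicit Defensive.

Import Order.TTheory GRing.Theory Num.Theory.
Import numFieldNormedType.Exports.

Local Open Scope classical_set_scope.
Local Open Scope ring_scope.

Record category := Category {
  Obj :> Type;
  Hom : Obj -> Obj -> Type;
  idm : forall X, Hom X X;
  compm : forall X Y Z, Hom Y Z -> Hom X Y -> Hom X Z;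
  compm1 : forall X Y (f : Hom X Y), compm f (idm X) = f;
  comp1m : forall X Y (f : Hom X Y), compm (idm Y) f = f;
  compmA : forall X Y Z W (h : Hom Z W) (g : Hom Y Z) (f : Hom X Y),
    compm h (compm g f) = compm (compm h g) f
}.
Arguments Hom {c} _ _.
Arguments idm {c} X.
Arguments compm {c X Y Z} _ _.

Notation "g \oc f" := (compm g f) (at level 50, left associativity).

Definition full_subcategory (C : category) (P : C -> Prop) : category :=
  @Category {X : C | P X} (fun X Y => Hom (proj1_sig X) (proj1_sig Y))
    (fun X => idm (proj1_sig X)) (fun _ _ _ g f => g \oc f)
    (fun _ _ => @compm1 C _ _) (fun _ _ => @comp1m C _ _)
    (fun _ _ _ _ => @compmA C _ _ _ _).

(* A terminal object together with binary products yields all finite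
   products. *)
Record finite_products (C : category) := FiniteProducts {
  one : C;
  bang : forall Z : C, Hom Z one;
  bang_unique : forall (Z : C) (f : Hom Z one), f = bang Z;
  prod_obj : C -> C -> C;
  proj_fst : forall X Y : C, Hom (prod_obj X Y) X;
  proj_snd : forall X Y : C, Hom (prod_obj X Y) Y;
  pairing : forall X Y Z : C, Hom Z X -> Hom Z Y -> Hom Z (prod_obj X Y);
  pairing_fst : forall (X Y Z : C) (f : Hom Z X) (g : Hom Z Y),
    proj_fst X Y \oc pairing f g = f;
  pairing_snd : forall (X Y Z : C) (f : Hom Z X) (g : Hom Z Y),
    proj_snd X Y \oc pairing f g = g;
  pairing_unique : forall (X Y Z : C) (h : Hom Z (prod_obj X Y)),
    h = pairing (proj_fst X Y \oc h) (proj_snd X Y \oc h)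
}.
Arguments prod_obj {C} f X Y : rename.
Arguments proj_fst {C} f X Y : rename.
Arguments proj_snd {C} f X Y : rename.
Arguments pairing {C} f {X Y Z} _ _ : rename.

Definition prod_map (C : category) (F : finite_products C) (X X' Y Y' : C)
    (f : Hom X X') (g : Hom Y Y') : Hom (prod_obj F X Y) (prod_obj F X' Y') :=
  pairing F (f \oc proj_fst F X Y) (g \oc proj_snd F X Y).

(* For each X the functor (- x X) has a right adjoint (-)^X, presented by the
   universal arrows ev : Y^X x X -> Y. *)
Record cartesian_closed (C : category) := CartesianClosed {
  ccc_products :> finite_products C;
  exp_obj : C -> C -> C;
  ev : forall X Y : C, Hom (prod_obj ccc_products (exp_obj X Y) X) Y;
  transpose : forall X Y Z : C,
    Hom (prod_obj ccc_products Z X) Y -> Hom Z (exp_obj X Y);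
  ev_transpose : forall (X Y Z : C) (f : Hom (prod_obj ccc_products Z X) Y),
    ev X Y \oc prod_map ccc_products (transpose f) (idm X) = f;
  transpose_unique : forall (X Y Z : C) (g : Hom Z (exp_obj X Y)),
    g = transpose (ev X Y \oc prod_map ccc_products g (idm X))
}.

Definition top_comp (X Y Z : topologicalType)
  (g : continuousType Y Z) (f : continuousType X Y) : continuousType X Z :=
  g \o f.

Lemma top_comp1 (X Y : topologicalType) (f : continuousType X Y) :
  top_comp f idfun = f.
Proof. exact/continuousEP. Qed.

Lemma top_1comp (X Y : topologicalType) (f : continuousType X Y) :
  top_comp idfun f = f.
Proof. exact/continuousEP. Qed.

Lemma top_compA (X Y Z W : topologicalType) (h : continuousType Z W)
    (g : continuousType Y Z) (f : continuousType X Y) :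
  top_comp h (top_comp g f) = top_comp (top_comp h g) f.
Proof. exact/continuousEP. Qed.

Definition Top : category :=
  @Category topologicalType (fun X Y => continuousType X Y) (fun _ => idfun)
    top_comp top_comp1 top_1comp top_compA.

(* The standard n-simplex; as a type it carries the subspace topology induced
   from R^(n+1). *)
Definition simplex (R : realType) (n : nat) : set 'rV[R]_n.+1 :=
  [set t : 'rV[R]_n.+1 | (forall i, 0 <= t ord0 i) /\ \sum_i t ord0 i = 1].
Arguments simplex : clear implicits.

Definition has_final_topology (X : topologicalType) (I : Type)
    (D : I -> topologicalType) (f : forall i, D i -> X) :=
  forall U : set X, open U <-> forall i, open (f i @^-1` U).

Definition singular_simplex (R : realType) (X : topologicalType) : Type :=
  {n : nat & continuousType (simplex R n) X}.

Definition numerically_generated (R : realType) (X : topologicalType) :=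
  @has_final_topology X (singular_simplex R X)
    (fun s => simplex R (projT1 s)) (fun s => projT2 s).

Definition NG (R : realType) : category :=
  @full_subcategory Top (numerically_generated R).

(* Main.v *)
Require Import Defs.
From HB Require Import structures.
From mathcomp Require Import all_boot all_order all_algebra.
From mathcomp Require Import all_classical all_reals all_analysis.

(** Every object built here carries a final topology with respect to a chosen
    family of probes, i.e. maps from standard simplexes into a set. Such a
    topology is always numerically generated, because the probes become
    singular simplexes ([probe_space_NG]). A map out of a numerically
    generated space is continuous as soon as its composites with the singular
    simplexes are.

    - The product of X and Y is the set X * Y probed by the maps into the
      ordinary topological product that are continuous.
    - The exponential Y^X is the set of continuous maps X -> Y, where
      s : Delta^n -> Y^X is a probe when (t, u) |-> s t (b u) is jointly
      continuous on Delta^n * Delta^m for each singular simplex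
      b : Delta^m -> X.

    Two facts make evaluation and transposition continuous.

    Evaluation needs every continuous map Delta^n -> Y^X to be a probe
    ([exp_space_probe]); a final topology could a priori acquire more
    continuous maps than the probes one starts with. Restriction along
    b : Delta^m -> X sends probes to maps that are continuous for the
    compact-open topology on the maps Delta^m -> Y, hence is itself continuous
    on Y^X. As Delta^m is compact Hausdorff, a continuous map from Delta^n to
    that compact-open function space uncurries to a jointly continuous map.

    Transposition needs joint continuity on Delta^n * Delta^m of a map only
    known to be continuous along singular simplexes of a product
    ([transpose_continuous]). This holds because Delta^n * Delta^m is a retract
    of a single simplex ([simplex_prod_retract]): view a point of a simplex as
    a probability distribution on its vertices, so that a pair of distributions
    embeds as its product distribution and is recovered by taking the
    marginals. *)

Set Implicit Arguments.
Unset Strict Implicit.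
Unset Printing Implicit Defensive.

Import Order.TTheory GRing.Theory Num.Theory.
Import numFieldNormedType.Exports.

Local Open Scope classical_set_scope.
Local Open Scope ring_scope.

(** * Pairs, matrices and subspaces *)

Lemma continuous_composition (X Y Z : topologicalType)
    (f : X -> Y) (g : Y -> Z) :
  continuous f -> continuous g -> continuous (g \o f).
Proof. by move=> cf cg x; exact: continuous_comp (cf x) (cg (f x)). Qed.

Lemma continuous_pair (X Y Z : topologicalType) (f : X -> Y) (g : X -> Z) :
  continuous f -> continuous g -> continuous (fun x => (f x, g x)).
Proof. by move=> cf cg x; exact: cvg_pair (cf x) (cg x). Qed.

Lemma continuous_mx (K X : topologicalType) m n
    (f : X -> 'M[K]_(m, n)) :
  (forall i j, continuous (fun x => f x i j)) -> continuous f.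
Proof.
move=> cf x U [P Px PU].
have : \forall y \near x, forall i j, P i j (f y i j).
  apply: filter_forall => i; apply: filter_forall => j.
  exact: cf (Px i j).
by apply: filterS => y; exact: PU.
Qed.

Lemma continuous_set_val (X : topologicalType) (A : set X) :
  continuous (set_val : A -> X).
Proof. exact: initial_continuous. Qed.

Lemma continuous_into_set (X Y : topologicalType) (A : set X) (f : Y -> A) :
  continuous (set_val \o f) -> continuous f.
Proof. exact: continuous_comp_initial. Qed.

(** A cluster point in X of the image filter that lies in A is a cluster point
    in the subspace, whose neighbourhoods are traces of those of X. *)
Lemma compact_set_type (X : topologicalType) (A : set X) :
  compact A -> compact [set: A].
Proof.
move=> cA F FF _.
have FA : (set_val @ F) A.
  by apply: (@filterE _ F) => x; exact: set_valP.
have [p [Ap clp]] := cA _ _ FA.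
exists (exist _ p (mem_set Ap)); split=> // B C FB [_ [[W oW <-] /= Wp WC]].
have FB' : (set_val @ F) (set_val @` B).
  by apply: (@filterS _ F) FB => b Bb; exists b.
have [_ [[b Bb <-] Wb]] := clp _ _ FB' (open_nbhs_nbhs (conj oW Wp)).
by exists b; split=> //; exact: WC.
Qed.

Lemma hausdorff_set_type (X : topologicalType) (A : set X) :
  hausdorff_space X -> hausdorff_space A.
Proof.
move=> hX p q clpq; apply/val_inj/hX => B C Bp Cq.
have [r [Br Cr]] := clpq _ _ (@continuous_set_val _ A p _ Bp)
  (@continuous_set_val _ A q _ Cq).
by exists (set_val r).
Qed.

(** * Topology of the standard simplexes *)

Section Simplex.
Variable R : realType.

Lemma simplex_ge0 n (t : simplex R n) i : 0 <= set_val t ord0 i.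
Proof. by have [] := set_valP t. Qed.

Lemma simplex_sum1 n (t : simplex R n) : \sum_i set_val t ord0 i = 1.
Proof. by have [] := set_valP t. Qed.

Lemma simplex_coord_continuous n i :
  continuous (fun t : simplex R n => set_val t ord0 i).
Proof.
move=> t; apply: (continuous_comp (f := set_val)
  (g := fun v : 'rV[R]_n.+1 => v ord0 i)).
  exact: continuous_set_val.
exact: coord_continuous.
Qed.

Lemma continuous_sum (X : topologicalType) (I : finType) (F : I -> X -> R) :
  (forall i, continuous (F i)) -> continuous (fun x => \sum_i F i x).
Proof. by move=> cF; apply: continuous_big => //; exact: add_continuous. Qed.

(** A closed subset of the unit cube. *)
Lemma simplex_compact n : compact (simplex R n).
Proof.
have cube : compact [set v : 'rV[R]_n.+1 |
    forall i, `[0, 1]%classic (v ord0 i)].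
  apply: (@rV_compact R n.+1 (fun=> `[0, 1]%classic)) => _.
  exact: segment_compact.
apply: (subclosed_compact _ cube).
  have -> : simplex R n =
     (\bigcap_i [set t : 'rV[R]_n.+1 | 0 <= t ord0 i]) `&`
       [set t | \sum_i t ord0 i = 1].
    apply/seteqP; split=> t [t0 t1]; split=> // i; last exact: t0.
    by move=> _; exact: t0.
  apply: closedI.
    apply: closed_bigI => i _.
    apply: (@preimage_closed _ _ (fun t : 'rV[R]_n.+1 => t ord0 i)
      [set x | 0 <= x]).
      by move=> t _; exact: coord_continuous.
    exact: closed_ge.
  apply: (@preimage_closed _ _ (fun t : 'rV[R]_n.+1 => \sum_i t ord0 i)
    [set x | x = 1]).
    by move=> t _; apply: continuous_sum => i; exact: coord_continuous.
  exact: closed_eq.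
move=> t [t0 t1] i /=; rewrite in_itv/= t0/= -t1 (bigD1 i)//= lerDl.
by apply: sumr_ge0 => j _.
Qed.

Lemma simplex_hausdorff n : hausdorff_space (simplex R n).
Proof. exact/hausdorff_set_type/norm_hausdorff. Qed.

Lemma simplex_locally_compact n : locally_compact [set: simplex R n].
Proof.
move=> t _; rewrite withinET; exists setT; first exact: filterT.
by split; [exact/compact_set_type/simplex_compact | exact: closedT].
Qed.

Lemma sum_mxvec (V : nmodType) m n (A : 'M[V]_(m, n)) :
  \sum_k mxvec A ord0 k = \sum_i \sum_j A i j.
Proof.
rewrite pair_big /= (reindex _ (curry_mxvec_bij m n)) /=.
by apply: eq_bigr => -[i j] _; rewrite mxvecE.
Qed.

(** This value makes [(simplex_prod n m).+1] convertible to [n.+1 * m.+1], so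
    that the vertices of that simplex are pairs of vertices and its points
    reshape into [n.+1] by [m.+1] matrices. *)
Definition simplex_prod n m := (m + n * m.+1)%N.

(** The section [i] forms the product of two probability distributions, and
    the retraction [r] takes the two marginals of a joint distribution, i.e.
    the row and column sums of the corresponding matrix. *)
Lemma simplex_prod_retract n m :
  exists (i : simplex R n * simplex R m -> simplex R (simplex_prod n m))
         (r : simplex R (simplex_prod n m) -> simplex R n * simplex R m),
    [/\ continuous i, continuous r & cancel i r].
Proof.
pose i0 (p : simplex R n * simplex R m) : 'rV[R]_(n.+1 * m.+1) :=
  mxvec ((set_val p.1)^T *m set_val p.2).
have i0E p j k : i0 p ord0 (mxvec_index j k) =
    set_val p.1 ord0 j * set_val p.2 ord0 k.
  by rewrite mxvecE mxE big_ord1 mxE.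
have i0P p : simplex R (simplex_prod n m) (i0 p).
  split.
    move=> l; case/mxvec_indexP: (l : 'I_(n.+1 * m.+1)) => j k.
    by rewrite i0E mulr_ge0// simplex_ge0.
  rewrite (sum_mxvec ((set_val p.1)^T *m set_val p.2)).
  rewrite -[RHS](simplex_sum1 p.1); apply: eq_bigr => j _.
  under eq_bigr do rewrite mxE big_ord1 mxE.
  by rewrite -mulr_sumr simplex_sum1 mulr1.
pose V (t : simplex R (simplex_prod n m)) : 'M[R]_(n.+1, m.+1) :=
  vec_mx (set_val t : 'rV_(n.+1 * m.+1)).
have V0 t j k : 0 <= V t j k by rewrite mxE simplex_ge0.
have V1 t : \sum_j \sum_k V t j k = 1.
  by rewrite -sum_mxvec vec_mxK -[RHS](simplex_sum1 t).
have Vc j k : continuous (fun t => V t j k).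
  rewrite /V; under eq_fun do rewrite mxE.
  exact: (@simplex_coord_continuous (simplex_prod n m)).
have r1P t : simplex R n (\row_j \sum_k V t j k).
  split; first by move=> j; rewrite mxE; apply: sumr_ge0 => k _.
  by under eq_bigr do rewrite mxE; exact: V1.
have r2P t : simplex R m (\row_k \sum_j V t j k).
  split; first by move=> k; rewrite mxE; apply: sumr_ge0 => j _.
  by under eq_bigr do rewrite mxE; rewrite exchange_big; exact: V1.
pose mk l v (vP : simplex R l v) : simplex R l := exist _ v (mem_set vP).
exists (fun p => mk _ _ (i0P p)), (fun t => (mk _ _ (r1P t), mk _ _ (r2P t))).
split.
- apply: continuous_into_set; apply: continuous_mx => a; rewrite ord1.
  move=> l; case/mxvec_indexP: (l : 'I_(n.+1 * m.+1)) => j k p.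
  rewrite /comp /=.
  under eq_fun do rewrite i0E.
  have c1 : continuous
      (fun p : simplex R n * simplex R m => set_val p.1 ord0 j).
    move=> q; apply: (continuous_comp (f := fst)
      (g := fun t : simplex R n => set_val t ord0 j)).
      exact: cvg_fst.
    exact: simplex_coord_continuous.
  have c2 : continuous
      (fun p : simplex R n * simplex R m => set_val p.2 ord0 k).
    move=> q; apply: (continuous_comp (f := snd)
      (g := fun t : simplex R m => set_val t ord0 k)).
      exact: cvg_snd.
    exact: simplex_coord_continuous.
  exact: continuousM (c1 p) (c2 p).
- have c1 : continuous (fun t => mk _ _ (r1P t)).
    apply: continuous_into_set; apply: continuous_mx => a j; rewrite /comp /=.
    by under eq_fun do rewrite mxE; apply: continuous_sum => k.
  have c2 : continuous (fun t => mk _ _ (r2P t)).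
    apply: continuous_into_set; apply: continuous_mx => a k; rewrite /comp /=.
    by under eq_fun do rewrite mxE; apply: continuous_sum => j.
  exact: continuous_pair c1 c2.
- move=> p; rewrite [RHS]surjective_pairing.
  have Vi j k : V (mk _ _ (i0P p)) j k =
      set_val p.1 ord0 j * set_val p.2 ord0 k by rewrite mxE i0E.
  congr pair; apply/val_inj/rowP => j; rewrite mxE.
    under eq_bigr do rewrite Vi.
    by rewrite -mulr_sumr simplex_sum1 mulr1.
  under eq_bigr do rewrite Vi.
  by rewrite -mulr_suml simplex_sum1 mul1r.
Qed.

End Simplex.

(** * Final topologies with respect to probes *)

Section ProbeSpace.
Variables (R : realType) (T : Type).

(** The family [P] is a phantom parameter: it selects the topology put on the
    carrier [T]. *)
Definition probe_space (P : forall n, (simplex R n -> T) -> Prop) : Type := T.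

Variable P : forall n, (simplex R n -> T) -> Prop.

HB.instance Definition _ := gen_eqMixin (probe_space P).
HB.instance Definition _ := gen_choiceMixin (probe_space P).

Definition probe_open (U : set (probe_space P)) :=
  forall n s, @P n s -> open (s @^-1` U).

Let probe_openT : probe_open setT.
Proof. by move=> n s _; rewrite preimage_setT; exact: openT. Qed.

Let probe_openI : setI_closed probe_open.
Proof. by move=> A B oA oB n s Ps; apply: openI; [exact: oA|exact: oB]. Qed.

Let probe_open_bigU (I : Type) (f : I -> set (probe_space P)) :
  (forall i, probe_open (f i)) -> probe_open (\bigcup_i f i).
Proof.
by move=> of_ n s Ps; apply: bigcup_open => i _; exact: of_.
Qed.

HB.instance Definition _ := isOpenTopological.Build (probe_space P)
  probe_openT probe_openI probe_open_bigU.

Lemma probe_spaceP (U : set (probe_space P)) :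
  open U <-> forall n s, @P n s -> open (s @^-1` U).
Proof. by []. Qed.

Lemma probe_continuous n (s : simplex R n -> T) :
  P s -> continuous (s : simplex R n -> probe_space P).
Proof. by move=> Ps; apply/continuousP => U /probe_spaceP; exact. Qed.

Lemma continuous_from_probe_space (Y : topologicalType)
    (f : probe_space P -> Y) :
  (forall n (s : simplex R n -> T), P s -> continuous (f \o s)) ->
  continuous f.
Proof.
move=> cf; apply/continuousP => U oU; apply/probe_spaceP => n s Ps.
by move/continuousP: (cf n s Ps) => /(_ _ oU).
Qed.

(** The singular simplexes of a probe space include the probes, and testing
    openness on more continuous maps cannot change a final topology. *)
Lemma probe_space_NG : numerically_generated R (probe_space P).
Proof.
move=> U; split=> [oU [n s]|oU]; last (apply/probe_spaceP => n s Ps).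
  by have /continuousP := @cts_fun _ _ s; exact.
exact: (oU (existT _ n (mkcts (probe_continuous Ps) :
  continuousType (simplex R n) (probe_space P)))).
Qed.

End ProbeSpace.

(** * Products and function spaces of numerically generated spaces *)

Section NG.
Variable R : realType.

Lemma continuous_from_NG (X Y : topologicalType) (f : X -> Y) :
  numerically_generated R X ->
  (forall n (s : continuousType (simplex R n) X), continuous (f \o s)) ->
  continuous f.
Proof.
move=> ngX cf; apply/continuousP => U oU; apply/ngX => -[n s].
by move/continuousP: (cf n s) => /(_ _ oU).
Qed.

(** The coreflection of topological spaces onto numerically generated ones:
    the two lemmas [continuous_from_ngify] and [continuous_into_ngify] express
    its universal property. *)
Definition ngify (X : topologicalType) : topologicalType :=
  probe_space (fun n (s : simplex R n -> X) => continuous s).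

Lemma ngify_probe (X : topologicalType) n (s : simplex R n -> X) :
  continuous s -> continuous (s : simplex R n -> ngify X).
Proof.
exact: (@probe_continuous R X (fun n (s : simplex R n -> X) => continuous s)).
Qed.

Lemma continuous_from_ngify (X Y : topologicalType) (f : X -> Y) :
  continuous f -> continuous (f : ngify X -> Y).
Proof.
move=> cf; apply: continuous_from_probe_space => n s cs.
exact: continuous_composition cs cf.
Qed.

Lemma continuous_into_ngify (X Z : topologicalType) (f : Z -> X) :
  numerically_generated R Z -> continuous f -> continuous (f : Z -> ngify X).
Proof.
move=> ngZ cf; apply: continuous_from_NG => // n s; apply: ngify_probe.
exact: continuous_composition (@cts_fun _ _ s) cf.
Qed.

Definition exp_probe (X Y : topologicalType) n
    (s : simplex R n -> continuousType X Y) :=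
  forall m (b : continuousType (simplex R m) X),
    continuous (fun p : simplex R n * simplex R m => s p.1 (b p.2)).

Definition exp_space (X Y : topologicalType) : topologicalType :=
  probe_space (@exp_probe X Y).

Definition exp_fun (X Y : topologicalType) (g : exp_space X Y) :
  continuousType X Y := g.

(** The topology generated by the probes has no further continuous maps from
    simplexes: precomposition with [b] is continuous into the compact-open
    function space on a simplex, where maps can be uncurried because simplexes
    are locally compact Hausdorff. *)
Lemma exp_space_probe (X Y : topologicalType) n
    (s : simplex R n -> exp_space X Y) :
  continuous s -> exp_probe s.
Proof.
move=> cs m b.
pose F (g : exp_space X Y) : {compact-open, simplex R m -> Y} :=
  exp_fun g \o b.
have cF : continuous F.
  apply: continuous_from_probe_space => k p pp.
  exact: (continuous_curry (pp m b)).1.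
have -> : (fun p => s p.1 (b p.2)) = uncurry (fun t u => exp_fun (s t) (b u)).
  by apply/funext => -[].
apply: continuous_uncurry.
- exact: simplex_locally_compact.
- exact: simplex_hausdorff.
- exact: continuous_composition cs cF.
- by move=> t; exact: continuous_composition (@cts_fun _ _ b) (@cts_fun _ _ _).
Qed.

(** A singular simplex of the product has components a and b, and
    evaluation along it is the joint map of a and b restricted to the
    diagonal. *)
Lemma ngify_eval_continuous (X Y : topologicalType) :
  continuous ((fun p => exp_fun p.1 p.2) : ngify (exp_space X Y * X)%type -> Y).
Proof.
apply: continuous_from_probe_space => n s cs.
have c1 : continuous (fst \o s).
  by apply: continuous_composition cs _ => x; exact: cvg_fst.
have c2 : continuous (snd \o s).
  by apply: continuous_composition cs _ => x; exact: cvg_snd.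
have p1 : exp_probe (fst \o s) := exp_space_probe c1.
have ce := p1 _ (mkcts c2 : continuousType _ _).
have cd : continuous (fun x : simplex R n => (x, x)).
  by apply: continuous_pair => x.
exact: continuous_composition cd ce.
Qed.

Lemma partial_application_continuous (X Y Z : topologicalType)
    (f : ngify (Z * X)%type -> Y) (z : Z) :
  numerically_generated R X -> continuous f ->
  continuous (fun x => f (z, x)).
Proof.
move=> ngX cf; apply: continuous_composition cf.
apply: continuous_into_ngify => //; apply: continuous_pair => x.
  exact: cvg_cst.
exact: cvg_id.
Qed.

(** For singular simplexes [a] of Z and [b] of X, the map [f] composed with
    [a * b] has to be shown jointly continuous. Composing further with the
    retraction [r] onto the product of simplexes gives a singular simplex of
    the product, to which the continuity of [f] applies; the section [i] then
    removes [r]. *)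
Lemma transpose_continuous (X Y Z : topologicalType)
    (f : ngify (Z * X)%type -> Y) (g : Z -> continuousType X Y) :
  numerically_generated R Z -> continuous f ->
  (forall z x, g z x = f (z, x)) ->
  continuous (g : Z -> exp_space X Y).
Proof.
move=> ngZ cf gE; apply: continuous_from_NG => // n a.
apply: (@probe_continuous R _ (@exp_probe X Y) n (g \o a)) => m b.
have [i [r [ci cr irK]]] := simplex_prod_retract R n m.
pose ab (p : simplex R n * simplex R m) : Z * X := (a p.1, b p.2).
have cab : continuous ab.
  apply: continuous_pair.
    by apply: continuous_composition (@cts_fun _ _ a) => x; exact: cvg_fst.
  by apply: continuous_composition (@cts_fun _ _ b) => x; exact: cvg_snd.
have cabr : continuous (ab \o r : _ -> ngify (Z * X)%type).
  exact/ngify_probe/(continuous_composition cr cab).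
have -> : (fun p => (g \o a) p.1 (b p.2)) = f \o (ab \o r) \o i.
  by apply/funext => p /=; rewrite irK gE.
exact: continuous_composition ci (continuous_composition cabr cf).
Qed.
End NG.

(** * The cartesian closed structure *)

Section Category.
Variable R : realType.
Local Notation Hom := Defs.Hom.

Definition NG_obj (X : topologicalType) (ngX : numerically_generated R X) :
    NG R :=
  exist (numerically_generated R) X ngX.

Definition NG_space (X : NG R) : topologicalType := proj1_sig X.

Definition NG_spaceP (X : NG R) : numerically_generated R (NG_space X) :=
  proj2_sig X.

Definition NG_fun (X Y : NG R) (f : Hom X Y) :
  continuousType (NG_space X) (NG_space Y) := f.

Definition NG_hom (X Y : NG R) (f : NG_space X -> NG_space Y)
  (cf : continuous f) : Hom X Y := mkcts cf : continuousType _ _.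

Lemma NG_hom_ext (X Y : NG R) (f g : Hom X Y) :
  NG_fun f =1 NG_fun g -> f = g.
Proof. by move=> fg; apply/continuousEP. Qed.

Definition NG_unit : NG R :=
  NG_obj (@probe_space_NG R _ (fun n (_ : simplex R n -> unit) => True)).

Lemma NG_bang_continuous (Z : NG R) :
  continuous ((fun=> tt) : NG_space Z -> NG_space NG_unit).
Proof. by move=> x; exact: cvg_cst. Qed.

Lemma NG_bang_unique (Z : NG R) (f : Hom Z NG_unit) :
  f = NG_hom (@NG_bang_continuous Z).
Proof. by apply: NG_hom_ext => z; case: (NG_fun f z). Qed.

Definition NG_prod (X Y : NG R) : NG R :=
  NG_obj (@probe_space_NG R _
    (fun n (s : simplex R n -> NG_space X * NG_space Y) => continuous s)).

Lemma NG_fst_continuous (X Y : NG R) :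
  continuous (fst : NG_space (NG_prod X Y) -> NG_space X).
Proof. by apply: continuous_from_ngify => x; exact: cvg_fst. Qed.

Lemma NG_snd_continuous (X Y : NG R) :
  continuous (snd : NG_space (NG_prod X Y) -> NG_space Y).
Proof. by apply: continuous_from_ngify => x; exact: cvg_snd. Qed.

Lemma NG_pair_continuous (X Y Z : NG R) (f : Hom Z X) (g : Hom Z Y) :
  continuous ((fun z => (NG_fun f z, NG_fun g z)) :
    NG_space Z -> NG_space (NG_prod X Y)).
Proof.
apply: continuous_into_ngify; first exact: NG_spaceP.
by apply: continuous_pair; exact: cts_fun.
Qed.

Definition NG_products : finite_products (NG R).
Proof.
apply: (@FiniteProducts (NG R) NG_unit _ NG_bang_unique NG_prod
  (fun X Y => NG_hom (@NG_fst_continuous X Y))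
  (fun X Y => NG_hom (@NG_snd_continuous X Y))
  (fun X Y Z f g => NG_hom (@NG_pair_continuous X Y Z f g))).
- by move=> X Y Z f g; exact: NG_hom_ext.
- by move=> X Y Z f g; exact: NG_hom_ext.
- by move=> X Y Z h; apply: NG_hom_ext => z; exact: surjective_pairing.
Defined.

Definition NG_exp (X Y : NG R) : NG R :=
  NG_obj (@probe_space_NG R _ (@exp_probe R (NG_space X) (NG_space Y))).

Definition NG_eval (X Y : NG R) : Hom (prod_obj NG_products (NG_exp X Y) X) Y :=
  @NG_hom (NG_prod (NG_exp X Y) X) Y _
    (@ngify_eval_continuous R (NG_space X) (NG_space Y)).

Definition NG_curry (X Y Z : NG R) (f : Hom (prod_obj NG_products Z X) Y)
    (z : NG_space Z) : continuousType (NG_space X) (NG_space Y) :=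
  mkcts (@partial_application_continuous R _ _ _ _ z (@NG_spaceP X)
    (@cts_fun _ _ (@NG_fun (NG_prod Z X) Y f))).

Lemma NG_curry_continuous (X Y Z : NG R)
    (f : Hom (prod_obj NG_products Z X) Y) :
  continuous (NG_curry f : NG_space Z -> NG_space (NG_exp X Y)).
Proof.
by apply: (transpose_continuous (@NG_spaceP Z)
  (@cts_fun _ _ (@NG_fun (NG_prod Z X) Y f))).
Qed.

End Category.

Theorem corollary4p6 (R : realType) : inhabited (cartesian_closed (NG R)).
Proof.
constructor; apply: (@CartesianClosed (NG R) (NG_products R) (@NG_exp R)
  (@NG_eval R) (fun X Y Z f => NG_hom (@NG_curry_continuous R X Y Z f))).
- by move=> X Y Z f; apply: NG_hom_ext => -[z x].
- move=> X Y Z g; apply: NG_hom_ext => z.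
  exact/continuousEP.
Qed.
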